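(* Let $T=(V,E)$ be a rooted symmetric tree with $q$ levels, root vertex $v_0$ and daughter degree sequence $(k_1,k_2,\ldots,k_{q-1})$, and let $h_i$ ($1\le i\le q$) be its $i$-th level vertex size. Then $T$ is graceful. Moreover, the function $f:V\to\{0,1,\ldots,|E|\}$ defined as follows is a graceful labelling of $T$: (1) $f(v_0)=0$; (2) if $v$ is a vertex at level $r$ with $2\le r\le q$, identified by the sequence $(x_1,x_2,\ldots,x_{r-1})$, and $r$ is even, then $$f(v)=(k_1-x_1)h_2-x_2h_3-\cdots-x_{r-1}h_r-\frac{r-2}{2};$$ (3) if $v$ is a vertex at level $r$ with $2\le r\le q$, identified by the sequence $(x_1,x_2,\ldots,x_{r-1})$, and $r$ is odd, then $$f(v)=x_1h_2+x_2h_3+\cdots+x_{r-1}h_r+\frac{r-1}{2}.$$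
   Context: Graceful labelling: for a finite tree $T=(V,E)$, an injective function $f:V\to\{0,1,\ldots,|E|\}$ such that the induced edge labelling $g:E\to\{1,\ldots,|E|\}$, $g(uv)=|f(u)-f(v)|$, is also injective. $T$ is graceful if it has a graceful labelling. Rooted symmetric tree: a finite rooted tree in which all vertices at the same level (distance from the root) have the same degree. Levels are numbered from $1$ to $q$, where level $1$ contains only the root $v_0$ and level $q$ is the last level. For $1\le i\le q$, $k_i$ is the common number of daughters (adjacent vertices at level $i+1$) of each vertex at level $i$; thus $k_i\ge 1$ for $i<q$ and $k_q=0$. The sequence $(k_1,\ldots,k_{q-1})$ is the daughter degree sequence of $T$. Identification of vertices by sequences: for each vertex at level $r<q$, the edges to its $k_r$ daughters are labelled, from left to right in a fixed embedding, by the distinct numbers $0,1,\ldots,k_r-1$. A non-root vertex $v$ at level $r$ is identified by the sequence $(x_1,\ldots,x_{r-1})$, with $0\le x_j\le k_j-1$, of the labels of the edges on the unique path from $v_0$ to $v$, in order starting from $v_0$. The $i$-th level vertex size $h_i$ is the number of vertices of the rooted subtree consisting of a vertex at level $i$ and all its descendants (this number is the same for all vertices at level $i$). In particular $h_1=|V|$ and $h_q=1$. *)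

(* Defs.v *)
From HB Require Import structures.
From mathcomp Require Import all_boot all_order all_algebra.
Set Implicit Arguments.
Unset Strict Implicit.
Unset Printing Implicit Defensive.

Import Order.TTheory GRing.Theory Num.Theory.
Local Open Scope ring_scope.

Section Trees.

(* A graph on V is given by its adjacency relation e. *)
Variables (V : finType) (e : rel V).

Definition simple_graph : Prop := symmetric e /\ irreflexive e.

(* For a symmetric relation, a ucycle of length 2 is an edge traversed back
   and forth, hence the bound 2 in the acyclicity condition. *)
Definition is_tree : Prop :=
  [/\ simple_graph,
      (exists v : V, true),
      (forall u v, connect e u v)
    & (forall c : seq V, ucycle e c -> (size c <= 2)%N)].

Definition edges : {set {set V}} :=
  [set [set p.1; p.2] | p in [pred p : V * V | e p.1 p.2]].

Definition degree (v : V) : nat := #|[set w | e v w]|.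

(* The value is #|V| when y is not reachable from x. *)
Definition distance (x y : V) : nat :=
  find (fun n => [exists p : n.-tuple V, path e x p && (last x p == y)])
       (iota 0 #|V|).

Definition graceful_labelling (f : V -> int) : Prop :=
  [/\ injective f,
      (forall v, 0 <= f v <= (#|edges|)%:Z),
      (forall u v, e u v -> 1 <= `|f u - f v| <= (#|edges|)%:Z)
    & (forall u v u' v', e u v -> e u' v' ->
         `|f u - f v| = `|f u' - f v'| -> [set u; v] = [set u'; v'])].

Definition graceful : Prop := exists f : V -> int, graceful_labelling f.

Section Rooted.

Variable v0 : V.

Definition level (v : V) : nat := (distance v0 v).+1.

Definition rooted_symmetric_tree : Prop :=
  is_tree /\ (forall u v, level u = level v -> degree u = degree v).

Definition daughters (v : V) : {set V} :=
  [set w | e v w & level w == (level v).+1].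

Definition subtree (v : V) : {set V} :=
  [set w | connect (fun x y => y \in daughters x) v w].

(* k_i and h_i: in a rooted symmetric tree they do not depend on the vertex
   picked at level i; the value 0 is used only when level i is empty. *)
Definition daughter_degree (i : nat) : nat :=
  if [pick v | level v == i] is Some v then #|daughters v| else 0%N.

Definition level_size (i : nat) : nat :=
  if [pick v | level v == i] is Some v then #|subtree v| else 0%N.

(* lab u v is the label of the edge from u to its daughter v. As u has
   daughter_degree (level u) daughters, their labels are exactly
   0, ..., daughter_degree (level u) - 1, and every left-to-right order of the
   daughters arises in this way. *)
Definition daughter_edge_labels (lab : V -> V -> nat) : Prop :=
  forall u, {in daughters u, forall v, (lab u v < daughter_degree (level u))%N}
         /\ {in daughters u &, injective (lab u)}.

(* The vertices other than v0 on the path from v0 to v, in order; in a tree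
   there is exactly one such path, so the choice is forced. *)
Definition root_path (v : V) : seq V :=
  if [pick p : (distance v0 v).-tuple V |
       [&& path e v0 p, uniq (v0 :: p) & last v0 p == v]] is Some p
  then tval p else [::].

(* The sequence (x_1, ..., x_{r-1}) identifying a vertex v of level r. *)
Definition vertex_seq (lab : V -> V -> nat) (v : V) : seq nat :=
  pairmap lab v0 (root_path v).

Definition symmetric_tree_labelling (lab : V -> V -> nat) (v : V) : int :=
  let k := daughter_degree in
  let h := level_size in
  let r := level v in
  let x j := nth 0%N (vertex_seq lab v) j.-1 in
  if v == v0 then 0
  else if ~~ odd r then
    ((k 1%N)%:Z - (x 1%N)%:Z) * (h 2%N)%:Z
      - \sum_(2 <= j < r) (x j)%:Z * (h j.+1)%:Z - ((r - 2)./2)%:Z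
  else
    \sum_(1 <= j < r) (x j)%:Z * (h j.+1)%:Z + ((r - 1)./2)%:Z.

End Rooted.

End Trees.

(* Main.v *)
Require Import Defs.
From mathcomp Require Import all_boot all_order all_algebra.
From mathcomp Require Import zify ring.

Set Implicit Arguments.
Unset Strict Implicit.
Unset Printing Implicit Defensive.

Import Order.TTheory GRing.Theory Num.Theory.
Local Open Scope ring_scope.

(** A tree of depth q whose root has k daughters is k copies of one smaller
    symmetric tree, hung below a new root; say the copies have h vertices each.
    Unfolding the closed formula gives a recursion for the labelling F of the
    whole tree in terms of the labelling F' of a copy: on copy x,
    F = (k - x) h - F' on the even levels of the whole tree, and
    F = (x + 1) h - F' on its odd levels ([symmetric_tree_labellingE],
    [vertex_labelE]). Everything then follows by induction on the depth.

    Vertex labels. F' takes values in [0, h - 1], so F determines the block of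
    h consecutive integers in which it lies. Two vertices in the same block
    either have the same x and the same parity of level, or have opposite
    parities and x + y = k - 1. In both cases their F' agree, hence so do their
    positions inside the copies, and this excludes opposite parities
    ([vertex_label_inj]).

    Edge labels. The difference of F along an edge is, up to a sign that only
    depends on the level, a quantity S ([vertex_label_rcons]) with
    S = (k - x) h on the edge from the root to copy x, and
    S = (k - 1 - 2 x) h + S' inside copy x. By induction the values |S'| are
    distinct and lie in [1, h - 1]. So an inner S is never a multiple of h, and
    |S| = |T| for inner edges forces either x = y and S' = T', or
    x + y = k - 1 and S' = - T'. In the second case |S'| = |T'|, so the edges
    have the same position, S' = T' and S' = 0, which is impossible
    ([signed_edge_label_inj]).

    On the graph side, acyclicity makes the path from the root to a vertex
    unique ([tree_uniq_path]), so that vertices are faithfully described by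
    their root paths: an edge extends one root path by one vertex
    ([edge_root_path]) and a subtree is the set of extensions of a root path
    ([mem_subtree]). This yields the recursion h_i = 1 + k_i h_(i+1)
    ([level_size_rec]) and |E| = |V| - 1 ([card_edges]). *)

(** * Labels of sequences *)

(** Reads off the first entry of a sequence from its label: an equality
    a h + r = b h + s with r - s smaller than h forces a = b. *)
Lemma small_multiple_eq0 (m h r : int) : m * h = r -> `|r| < h -> m = 0.
Proof.
move=> <-; rewrite normrM => lt_mh.
have h_gt0 : 0 < h by apply: le_lt_trans lt_mh; rewrite mulr_ge0.
rewrite (gtr0_norm h_gt0) -[X in _ < X]mul1r ltr_pM2r // in lt_mh.
lia.
Qed.

Section Addresses.

(* The hypotheses on k and h are guarded because both vanish beyond the last
   level of a tree. *)
Variables k h : nat -> nat.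
Hypothesis h_rec : forall i, (0 < h i)%N -> h i = (k i * h i.+1).+1.
Hypothesis h_succ_gt0 : forall i, (0 < k i)%N -> (0 < h i.+1)%N.

Fixpoint address i xs :=
  if xs is x :: xs' then (x < k i)%N && address i.+1 xs' else true.

(** The label that the closed formula gives to a vertex of a subtree rooted at
    level i when this subtree is regarded as a tree of its own; xs leads from
    its root to the vertex, so odd (size xs') means that the vertex is on an
    odd level of the subtree. *)
Fixpoint vertex_label i xs : int :=
  if xs is x :: xs' then
    (if odd (size xs') then x%:Z + 1 else (k i)%:Z - x%:Z) * (h i.+1)%:Z
    - vertex_label i.+1 xs'
  else 0.

(** The last edge on the way described by xs gets this label before the
    absolute value is taken. The offset k - 1 - 2x, symmetric around the middle
    copy, is the difference of the offsets k - x and x + 1 that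
    [vertex_label] uses for the two parities. *)
Fixpoint signed_edge_label i xs : int :=
  match xs with
  | [::] => 0
  | [:: x] => ((k i)%:Z - x%:Z) * (h i.+1)%:Z
  | x :: xs' =>
      ((k i)%:Z - 1 - 2 * x%:Z) * (h i.+1)%:Z + signed_edge_label i.+1 xs'
  end.

Lemma address_rcons i xs x :
  address i (rcons xs x) = address i xs && (x < k (i + size xs))%N.
Proof.
elim: xs i => [|y xs IHxs] i /=; first by rewrite addn0 andbT.
by rewrite IHxs addSnnS andbA.
Qed.

Lemma signed_edge_label_cons i x xs : xs != [::] ->
  signed_edge_label i (x :: xs) =
  ((k i)%:Z - 1 - 2 * x%:Z) * (h i.+1)%:Z + signed_edge_label i.+1 xs.
Proof. by case: xs. Qed.

(** The sharp lower bound for nonempty sequences is what separates the root,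
    labelled 0, from all other vertices. *)
Lemma vertex_label_bounds i xs : address i xs -> (0 < h i)%N ->
  (xs != [::])%:Z <= vertex_label i xs <= (h i)%:Z - 1.
Proof.
elim: xs i => [|x xs IHxs] i /=; first by move=> _; lia.
case/andP=> lt_xk add_xs h_gt0.
have h1_gt0 : (0 < h i.+1)%N by apply/h_succ_gt0/(leq_trans _ lt_xk).
have {IHxs add_xs} := IHxs _ add_xs h1_gt0; rewrite (h_rec h_gt0).
set c : int := if odd _ then _ else _; set F := vertex_label _ _ => bF.
have bc : 1 <= c <= (k i)%:Z by rewrite /c; case: ifP => _; lia.
have le_ch : (h i.+1)%:Z <= c * (h i.+1)%:Z by rewrite ler_peMl; lia.
have ge_ch : c * (h i.+1)%:Z <= (k i)%:Z * (h i.+1)%:Z.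
  by rewrite ler_wpM2r; lia.
lia.
Qed.

(** Comparing blocks of length h determines the relation between the first
    entries; opposite parities would make the tails equal by induction,
    although their sizes have different parities. *)
Lemma vertex_label_inj i xs ys :
  (0 < h i)%N -> address i xs -> address i ys ->
  vertex_label i xs = vertex_label i ys -> xs = ys.
Proof.
elim: xs i ys => [|x xs IHxs] i [|y ys] // h_gt0 add_xs add_ys.
- by have := vertex_label_bounds add_ys h_gt0 => /[swap] <-.
- by have := vertex_label_bounds add_xs h_gt0 => /[swap] ->.
move=> /=; case/andP: add_xs => lt_xk add_xs; case/andP: add_ys => lt_yk add_ys.
have h1_gt0 : (0 < h i.+1)%N by apply/h_succ_gt0/(leq_trans _ lt_xk).
have := vertex_label_bounds add_xs h1_gt0.
have := vertex_label_bounds add_ys h1_gt0.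
have := IHxs _ _ h1_gt0 add_xs add_ys; move: h1_gt0.
set F := vertex_label _ xs; set G := vertex_label _ ys.
move: (h i.+1) => H H_gt0.
case: (boolP (odd (size xs))) (boolP (odd (size ys))) => [ox|ex] [oy|ey];
  move=> inj bG bF E.
- have E0 : x%:Z - y%:Z = 0.
    by apply: (@small_multiple_eq0 _ H%:Z (F - G)); lia.
  by rewrite inj; [congr (_ :: _); lia | nia].
- have E0 : x%:Z + 1 + y%:Z - (k i)%:Z = 0.
    by apply: (@small_multiple_eq0 _ H%:Z (F - G)); lia.
  have /inj xs_ys : F = G by nia.
  by rewrite xs_ys (negPf ey) in ox.
- have E0 : (k i)%:Z - x%:Z - (y%:Z + 1) = 0.
    by apply: (@small_multiple_eq0 _ H%:Z (F - G)); lia.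
  have /inj xs_ys : F = G by nia.
  by rewrite -xs_ys (negPf ex) in oy.
- have E0 : y%:Z - x%:Z = 0.
    by apply: (@small_multiple_eq0 _ H%:Z (F - G)); lia.
  by rewrite inj; [congr (_ :: _); lia | nia].
Qed.

Lemma signed_edge_label_bounds i xs :
  address i xs -> (0 < h i)%N -> xs != [::] ->
  1 <= `|signed_edge_label i xs| <= (h i)%:Z - 1.
Proof.
elim: xs i => [|x xs IHxs] i //= /andP[lt_xk add_xs] h_gt0 _.
have h1_gt0 : (0 < h i.+1)%N by apply/h_succ_gt0/(leq_trans _ lt_xk).
have := IHxs _ add_xs h1_gt0; rewrite (h_rec h_gt0).
case: xs {IHxs} add_xs => [|y ys] _.
  move=> _; set c := _ - _.
  have bc : 1 <= c <= (k i)%:Z by rewrite /c; lia.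
  have le_ch : (h i.+1)%:Z <= c * (h i.+1)%:Z by rewrite ler_peMl; lia.
  have ge_ch : c * (h i.+1)%:Z <= (k i)%:Z * (h i.+1)%:Z.
    by rewrite ler_wpM2r; lia.
  lia.
move/(_ isT); set S := signed_edge_label _ _ => bS; set c := _ - 2 * _.
have bc : `|c| <= (k i)%:Z - 1 by rewrite /c; lia.
have ge_ch : `|c * (h i.+1)%:Z| <= ((k i)%:Z - 1) * (h i.+1)%:Z.
  by rewrite normrM ler_pM //; lia.
have neq0 : c * (h i.+1)%:Z + S != 0.
  apply/eqP => E0; have c0 : c = 0.
    by apply: (@small_multiple_eq0 _ (h i.+1)%:Z (- S)); lia.
  by rewrite c0 mul0r in E0; lia.
lia.
Qed.

(** The mirror copies x and k - 1 - x contribute c h + S' and c h - S' with the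
    same c, and these are distinct families because no S' vanishes. *)
Lemma signed_edge_label_inj i xs ys :
  (0 < h i)%N -> address i xs -> address i ys -> xs != [::] -> ys != [::] ->
  `|signed_edge_label i xs| = `|signed_edge_label i ys| -> xs = ys.
Proof.
elim: xs i ys => [|x xs IHxs] i [|y ys] // h_gt0.
move=> /= /andP[lt_xk add_xs] /andP[lt_yk add_ys] _ _.
have h1_gt0 : (0 < h i.+1)%N by apply/h_succ_gt0/(leq_trans _ lt_xk).
have bxs := signed_edge_label_bounds add_xs h1_gt0.
have bys := signed_edge_label_bounds add_ys h1_gt0.
have inj := IHxs _ _ h1_gt0 add_xs add_ys.
move: (h i.+1) h1_gt0 bxs bys => H H_gt0.
case: xs {IHxs} add_xs inj => [|a xs] _; case: ys add_ys => [|b ys] _ inj.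
- move=> _ _; rewrite !ger0_norm ?mulr_ge0 //; try lia.
  move=> E; congr [:: _].
  suff: x%:Z - y%:Z = 0 by lia.
  by apply: (@small_multiple_eq0 _ H%:Z 0); lia.
(* A first edge against an inner edge: the label of the former is a multiple
   of H, that of the latter is not. *)
- set T := signed_edge_label _ (b :: ys) => _ /(_ isT) bT E; exfalso.
  move: E; rewrite ger0_norm; last by rewrite mulr_ge0; lia.
  set c := _ - _; set d := _ - _ * _ => E.
  have E1 : (c - d) * H%:Z = T \/ (c + d) * H%:Z = - T by lia.
  case: E1 => E1; have Z := small_multiple_eq0 E1; rewrite Z in E1; lia.
- set S := signed_edge_label _ (a :: xs) => /(_ isT) bS _ E; exfalso.
  move: E; rewrite [in RHS]ger0_norm; last by rewrite mulr_ge0; lia.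
  set c := _ - _ * _; set d := _ - _ => E.
  have E1 : (d - c) * H%:Z = S \/ (d + c) * H%:Z = - S by lia.
  case: E1 => E1; have Z := small_multiple_eq0 E1; rewrite Z in E1; lia.
set S := signed_edge_label _ (a :: xs); set T := signed_edge_label _ (b :: ys).
move=> /(_ isT) bS /(_ isT) bT E.
(* Two inner edges: their signed labels are equal or opposite. *)
have {E}[E|E] : (2 * (y%:Z - x%:Z)) * H%:Z = T - S \/
  (2 * ((k i)%:Z - 1 - x%:Z - y%:Z)) * H%:Z = - (S + T) by lia.
- have Z : y%:Z - x%:Z = 0.
    by apply: (@small_multiple_eq0 _ H%:Z ((T - S) %/ 2)%Z); lia.
  rewrite Z in E.
  by rewrite inj //; [congr (_ :: _); lia | rewrite -/S -/T; lia].
- have Z : (k i)%:Z - 1 - x%:Z - y%:Z = 0.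
    by apply: (@small_multiple_eq0 _ H%:Z ((- (S + T)) %/ 2)%Z); lia.
  rewrite Z in E; have ST : `|S| = `|T| by lia.
  have eqST : S = T by rewrite /S /T inj.
  lia.
Qed.

(** The offset of copy x enters the two ends of an edge inside it with
    opposite parities, and the recursive terms enter with a minus sign; hence
    one change of sign for each level that is unfolded. *)
Lemma vertex_label_rcons i xs x :
  vertex_label i (rcons xs x) - vertex_label i xs =
  (-1) ^+ size xs * signed_edge_label i (rcons xs x).
Proof.
elim: xs i => [|y xs IHxs] i; first by rewrite /= expr0; ring.
rewrite rcons_cons signed_edge_label_cons; last by case: (xs).
rewrite exprS mulrDr -!mulrA -IHxs /= size_rcons /= -signr_odd.
by case: (odd _) => /=; rewrite ?expr0 ?expr1; ring.
Qed.

(** Unfolding the recursion twice cancels the signs of the tail. The terms in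
    size xs of the closed formula come from the + 1 in h_i = k_i h_(i+1) + 1,
    used once for every second level. *)
Lemma vertex_labelE i x xs : address i (x :: xs) ->
  vertex_label i (x :: xs) =
  let tail := \sum_(j < size xs) (nth 0%N xs j)%:Z * (h (i + j).+2)%:Z in
  if odd (size xs) then x%:Z * (h i.+1)%:Z + tail + (size xs).+1./2%:Z
  else ((k i)%:Z - x%:Z) * (h i.+1)%:Z - tail - (size xs)./2%:Z.
Proof.
elim: xs i x => [|y ys IHys] i x /= add_xs.
  by rewrite big_ord0 !subr0.
case/andP: (add_xs) => lt_xk add_ys.
have h1_gt0 : (0 < h i.+1)%N by apply/h_succ_gt0/(leq_trans _ lt_xk).
have /= -> := IHys i.+1 y add_ys.
rewrite big_ord_recl /= addn0.
under [in RHS]eq_bigr => j _ do rewrite /bump /= add1n addnS -addSn.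
set T := \sum_(_ < _) _.
case: (boolP (odd (size ys))) => [o|o] /=; first by nia.
by rewrite [in (x%:Z + 1) * _](h_rec h1_gt0) [in RHS](h_rec h1_gt0); lia.
Qed.

End Addresses.

(** * Root paths in a tree *)

Section Tree.

Variables (V : finType) (e : rel V) (v0 : V).
Hypothesis treeP : is_tree e.

Notation P := (root_path e v0).
Notation d := (distance e v0).
Notation D := (daughters e v0).

Lemma tree_sym : symmetric e. Proof. by case: treeP => [[]]. Qed.
Lemma tree_irr : irreflexive e. Proof. by case: treeP => [[]]. Qed.

Lemma uniq_path_size (x : V) p : uniq (x :: p) -> (size p < #|V|)%N.
Proof. by move/card_uniqP=> /= <-; apply: max_card. Qed.

(** A path from a to b avoiding their common neighbour x would close up to a
    cycle through x. This is the only use of acyclicity. *)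
Lemma tree_no_detour x a b : e x a -> e x b ->
  connect (fun u v => [&& e u v, u != x & v != x]) a b -> a = b.
Proof.
case: treeP => [[e_sym _] _ _ acyclic] xa xb /connectP[p path_p def_b].
case/shortenP: path_p def_b => {}p path_p uniq_p _ def_b.
have e_p : path e a p by apply: sub_path path_p => u v /and3P[].
apply/eqP/negPn/negP => neq_ab.
suff /acyclic : ucycle e [:: x, a & p].
  case: p def_b {path_p uniq_p e_p} => [|c p] // ab.
  by rewrite ab eqxx in neq_ab.
rewrite /ucycle /= xa rcons_path e_p -def_b e_sym xb /=.
rewrite [_ && uniq p]uniq_p andbT inE negb_or; apply/andP; split.
  by apply/eqP => def_x; rewrite def_x tree_irr in xa.
elim: (p) (a) path_p => //= c s IHs z /andP[/and3P[_ _ cx] path_s].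
by rewrite inE eq_sym negb_or cx (IHs c).
Qed.

Lemma tree_uniq_path x p q : path e x p -> path e x q ->
  uniq (x :: p) -> uniq (x :: q) -> last x p = last x q -> p = q.
Proof.
have avoid a s z : path e a s -> z \notin a :: s ->
    connect (fun u v => [&& e u v, u != z & v != z]) a (last a s).
  elim: s a => [|b s IHs] a //= /andP[ab path_s].
  rewrite !inE !negb_or => /and3P[za zb zs].
  apply: connect_trans (IHs _ path_s _); last by rewrite inE negb_or zb.
  by apply: connect1; rewrite /= ab 2![_ == z]eq_sym za.
elim: p x q => [|a p IHp] x [|b q] //.
- move=> _ _ _ /andP[/negP xNq _] def_x.
  by have := mem_last b q; rewrite -[last b q]def_x => /xNq.
- move=> _ _ /andP[/negP xNp _] _ def_x.
  by have := mem_last a p; rewrite [last a p]def_x => /xNp.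
move=> /andP[xa path_p] /andP[xb path_q].
move=> /andP[xNp uniq_p] /andP[xNq uniq_q] eq_last.
suff ab : a = b by rewrite -ab in path_q uniq_q eq_last *; rewrite (IHp a q).
apply: (tree_no_detour xa xb); apply: connect_trans (avoid _ _ _ path_p xNp) _.
rewrite [last a p]eq_last sym_connect_sym ?avoid // => u v.
by rewrite tree_sym; congr (_ && _); rewrite andbC.
Qed.

(** A shortest path is simple, so the constrained choice defining the root path
    never falls back on its default value. *)
Lemma root_path_spec v :
  [/\ path e v0 (P v), uniq (v0 :: P v), last v0 (P v) = v
    & size (P v) = d v].
Proof.
pose reach n := [exists p : n.-tuple V, path e v0 p && (last v0 p == v)].
have reachP p : path e v0 p -> last v0 p = v -> reach (size p).
  move=> path_p last_p; apply/existsP; exists (in_tuple p).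
  by rewrite path_p last_p /=.
have d_le p :
    path e v0 p -> last v0 p = v -> uniq (v0 :: p) -> (d v <= size p)%N.
  move=> path_p last_p uniq_p; rewrite leqNgt; apply/negP => lt_pd.
  have lt_p := uniq_path_size uniq_p.
  have /negbT/negP := before_find 0%N lt_pd; apply.
  by rewrite nth_iota // add0n; apply: reachP.
have [p [path_p uniq_p last_p size_p]] : exists p : seq V,
    [/\ path e v0 p, uniq (v0 :: p), last v0 p = v & size p = d v].
  have [_ _ conn _] := treeP; have /connectP[p path_p last_p] := conn v0 v.
  have {p path_p last_p} [p [path_p uniq_p last_p]] : exists p : seq V,
    [/\ path e v0 p, uniq (v0 :: p) & last v0 p = v].
    by move: last_p; case/shortenP: path_p => s ? ? _; exists s.
  have lt_p := uniq_path_size uniq_p.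
  have has_d : has reach (iota 0 #|V|).
    by apply/hasP; exists (size p); rewrite ?mem_iota //; apply: reachP.
  have := nth_find 0%N has_d; move: has_d; rewrite has_find size_iota => lt_d.
  rewrite nth_iota // add0n -/(d v) => /existsP[q /andP[path_q /eqP]].
  have size_q := size_tuple q.
  case/shortenP: path_q => s path_s uniq_s sub_s last_s.
  exists s; split => //; apply/eqP; rewrite eqn_leq d_le // andbT -size_q.
  by apply: uniq_leq_size => //; case/andP: uniq_s.
rewrite /root_path; case: pickP => [q /and3P[? ? /eqP ?]|no_path].
  by rewrite size_tuple.
have def_p : size p == d v by apply/eqP.
move: (no_path (Tuple def_p)); rewrite /= path_p last_p eqxx andbT.
by move/negP; case; exact: uniq_p.
Qed.

Lemma root_path_unique p v : path e v0 p -> uniq (v0 :: p) -> last v0 p = v ->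
  P v = p.
Proof.
move=> path_p uniq_p last_p; have [path_P uniq_P last_P _] := root_path_spec v.
by apply: (tree_uniq_path path_P); rewrite // last_P.
Qed.

Lemma root_path0 : P v0 = [::].
Proof. exact: root_path_unique. Qed.

Lemma root_path_inj : injective P.
Proof.
move=> u v eqP; have [_ _ <- _] := root_path_spec u.
by have [_ _ <- _] := root_path_spec v; rewrite eqP.
Qed.

Lemma root_path_cat p s v : P v = p ++ s -> P (last v0 p) = p.
Proof.
move=> Pv; have [] := root_path_spec v; rewrite Pv cat_path => /andP[path_p _].
rewrite -cat_cons cat_uniq => /and3P[uniq_p _ _] _ _.
exact: root_path_unique.
Qed.

Lemma root_path_last p v w : P v = rcons p w -> w = v.
Proof. by move=> Pv; have [_ _] := root_path_spec v; rewrite Pv last_rcons. Qed.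

(** If v is not on the root path of u, appending it gives the root path of v;
    otherwise the part of that path up to v is the root path of v, and u
    extends it. *)
Lemma edge_root_path u v :
  e u v = (P v == rcons (P u) v) || (P u == rcons (P v) u).
Proof.
have edge a b : P b = rcons (P a) b -> e a b.
  move=> Pb; have [_ _ lasta _] := root_path_spec a.
  by have [] := root_path_spec b; rewrite Pb rcons_path lasta => /andP[].
apply/idP/orP=> [uv|[/eqP/edge//|/eqP/edge]]; last by rewrite tree_sym.
have [path_u uniq_u last_u _] := root_path_spec u.
have [v_in|vN] := boolP (v \in v0 :: P u); [right | left]; apply/eqP;
  last first.
  apply: root_path_unique; rewrite ?last_rcons //.
    by rewrite rcons_path path_u last_u.
  by rewrite -rcons_cons rcons_uniq vN.
have [p1 [p2 [Pu last_p1]]] : exists p1 p2, P u = p1 ++ p2 /\ last v0 p1 = v.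
  by case/splitPl: v_in => p1 p2; exists p1, p2.
rewrite Pu in path_u uniq_u last_u; move: path_u uniq_u last_u.
rewrite cat_path -cat_cons cat_uniq last_cat last_p1.
move=> /andP[path_p1 _] /and3P[uniq_p1 disj _] last_p2.
rewrite (root_path_unique path_p1 uniq_p1 last_p1).
apply: root_path_unique; rewrite ?last_rcons //.
  by rewrite rcons_path path_p1 last_p1 tree_sym.
rewrite -rcons_cons rcons_uniq uniq_p1 andbT.
apply: contra disj => u_in; apply/hasP; exists u => //.
case: p2 last_p2 {Pu} => [/= def_u|c p2 /= <-]; last exact: mem_last.
by rewrite def_u tree_irr in uv.
Qed.

Lemma mem_daughters v w : (w \in D v) = (P w == rcons (P v) w).
Proof.
have [_ _ _ size_v] := root_path_spec v.
have [_ _ _ size_w] := root_path_spec w.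
rewrite inE edge_root_path /level -size_v -size_w eqSS.
apply/andP/eqP=> [[/orP[/eqP //|/eqP Pv]] /eqP|Pw]; last first.
  by split; rewrite Pw ?size_rcons eqxx.
by rewrite Pv size_rcons; lia.
Qed.

Lemma root_or_daughter v : v = v0 \/ exists u, v \in D u.
Proof.
case def_P: (P v) / (lastP (P v)) => [|p z].
  by left; apply: root_path_inj; rewrite root_path0.
have def_z := root_path_last def_P; rewrite def_z in def_P.
right; exists (last v0 p); rewrite mem_daughters def_P; apply/eqP.
congr (rcons _ _).
  by rewrite -cats1 in def_P; rewrite (root_path_cat def_P).
Qed.

Lemma tree_ind (Q : V -> Prop) :
  Q v0 -> (forall u w, w \in D u -> Q u -> Q w) -> forall v, Q v.
Proof.
move=> Q0 Qstep v; have [n] := ubnP (size (P v)); elim: n v => // n IHn v lt_vn.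
have [->//|[u vDu]] := root_or_daughter v; apply: (Qstep u) => //; apply: IHn.
by move: vDu lt_vn; rewrite mem_daughters => /eqP->; rewrite size_rcons.
Qed.

Lemma root_notin_daughters u : v0 \notin D u.
Proof. by rewrite mem_daughters root_path0; case: (P u). Qed.

Lemma daughter_neq_root u w : w \in D u -> w != v0.
Proof. by apply: contraTneq => ->; apply: root_notin_daughters. Qed.

Lemma daughters_inj u u' w : w \in D u -> w \in D u' -> u = u'.
Proof.
rewrite !mem_daughters => /eqP-> /eqP Puu'; apply: root_path_inj.
by case/rcons_inj: Puu'.
Qed.

Lemma level_daughter u w : w \in D u -> level e v0 w = (level e v0 u).+1.
Proof. by rewrite inE => /andP[_ /eqP]. Qed.

Lemma edge_daughters u v : e u v = (v \in D u) || (u \in D v).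
Proof. by rewrite !mem_daughters edge_root_path. Qed.

(** * Subtree sizes and number of edges *)

Lemma mem_subtree v w : (w \in subtree e v0 v) = prefix (P v) (P w).
Proof.
rewrite inE; apply/idP/idP=> [/connectP[p]|].
  elim: p v => [|u p IHp] v /= => [_ ->|/andP[uDv path_p] def_w].
    exact: prefix_refl.
  apply: prefix_trans (IHp _ path_p def_w).
  by move: uDv; rewrite mem_daughters => /eqP->; apply: prefix_rcons.
elim/tree_ind: w => [|u w wDu IHu].
  rewrite root_path0 prefixs0 => /eqP Pv.
  by rewrite (@root_path_inj v v0) ?connect0 // root_path0 Pv.
have := wDu; rewrite mem_daughters => /eqP Pw.
have [->|neq_vw] := eqVneq v w; first by rewrite connect0.
move=> /prefixP[s]; rewrite {}Pw; case/lastP: s => [|s z].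
  rewrite cats0 => Pv; case/eqP: neq_vw; apply: root_path_inj.
  by rewrite -Pv; apply/esym/eqP; rewrite -mem_daughters.
rewrite -rcons_cat => /rcons_inj[Pu _].
apply: connect_trans (IHu _) (connect1 wDu).
by rewrite Pu prefix_prefix.
Qed.

(** The vertices below v are sorted according to the vertex that follows v on
    their root paths. *)
Lemma mem_subtree_daughter v w u : w \in D v ->
  (u \in subtree e v0 w) =
  (u \in subtree e v0 v :\ v) && (nth v0 (P u) (size (P v)) == w).
Proof.
rewrite in_setD1 !mem_subtree mem_daughters => /eqP Pw.
apply/idP/idP=> [/prefixP[s]|/andP[/andP[neq_uv /prefixP[[|z s] Pu]]]].
- rewrite Pw cat_rcons => Pu.
  rewrite Pu prefix_prefix andbT nth_cat ltnn subnn eqxx andbT.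
  apply/eqP => def_u; move/(congr1 size): Pu; rewrite def_u size_cat /=; lia.
- by rewrite cats0 in Pu; rewrite (root_path_inj Pu) eqxx in neq_uv.
rewrite Pu nth_cat ltnn subnn /= => /eqP def_z.
by rewrite Pw -def_z -cat_rcons prefix_prefix.
Qed.

Lemma subtree_refl v : v \in subtree e v0 v.
Proof. by rewrite mem_subtree prefix_refl. Qed.

Lemma card_subtree v :
  #|subtree e v0 v| = (\sum_(w in D v) #|subtree e v0 w|).+1.
Proof.
rewrite (cardsD1 v) subtree_refl add1n -sum1_card; congr _.+1.
rewrite (partition_big (fun u => nth v0 (P u) (size (P v))) (mem (D v))) /=.
  apply: eq_bigr => w wDv; rewrite -sum1_card; apply: eq_bigl => u.
  by rewrite (mem_subtree_daughter u wDv).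
move=> u; rewrite in_setD1 mem_subtree => /andP[neq_uv /prefixP[[|z s] Pu]].
  by rewrite cats0 in Pu; rewrite (root_path_inj Pu) eqxx in neq_uv.
rewrite Pu nth_cat ltnn subnn /= mem_daughters.
rewrite -cat_rcons in Pu.
by have := root_path_cat Pu; rewrite last_rcons => ->.
Qed.

Lemma card_subtree_root : #|subtree e v0 v0| = #|V|.
Proof.
by apply: eq_card => v; rewrite mem_subtree root_path0 prefix0s.
Qed.

Definition parent w := odflt v0 [pick u | w \in D u].

Lemma parent_daughter w : w != v0 -> w \in D (parent w).
Proof.
rewrite /parent; case: pickP => [u //|no_u].
have [->|[u wDu]] := root_or_daughter w.
  by rewrite eqxx.
by rewrite no_u in wDu.
Qed.

Lemma daughter_parent u w : w \in D u -> parent w = u.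
Proof.
move=> wDu; apply: (@daughters_inj _ _ w) => //; apply: parent_daughter.
exact: daughter_neq_root wDu.
Qed.

Lemma edge_parent u v : e u v ->
  exists2 w, w != v0 & [set u; v] = [set parent w; w].
Proof.
rewrite edge_daughters => /orP[vDu|uDv].
  by exists v; rewrite ?(daughter_neq_root vDu) // (daughter_parent vDu).
by exists u; rewrite ?(daughter_neq_root uDv) // (daughter_parent uDv) setUC.
Qed.

(** Each edge joins exactly one vertex other than the root to its parent. *)
Lemma card_edges : #|edges e|.+1 = #|V|.
Proof.
have -> : edges e = [set [set parent w; w] | w in [set~ v0]].
  apply/setP=> E; apply/imsetP/imsetP=> [[[u v]]|[w]].
    rewrite inE /= => /edge_parent[w w0 ->] ->.
    by exists w; rewrite ?in_setC1.
  rewrite in_setC1 => /parent_daughter wD ->; exists (parent w, w) => //.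
  by rewrite inE /= edge_daughters wD.
rewrite card_in_imset ?cardsC1 ?prednK //.
  by apply/card_gt0P; exists v0.
move=> w w'; rewrite !in_setC1 => /parent_daughter wD /parent_daughter w'D eqE.
have: w \in [set parent w'; w'] by rewrite -eqE set22.
have: w' \in [set parent w; w] by rewrite eqE set22.
rewrite !in_set2 => /orP[/eqP w'_pw|/eqP-> //] /orP[/eqP w_pw'|/eqP-> //].
rewrite -w_pw' in w'D; rewrite -w'_pw in wD.
by have := level_daughter wD; have := level_daughter w'D; lia.
Qed.

Lemma level_le v : (level e v0 v <= #|V|)%N.
Proof.
have [_ uniq_v _ size_v] := root_path_spec v.
by rewrite /level -size_v (uniq_path_size uniq_v).
Qed.

Lemma degree_daughters v : degree e v = (#|D v| + (v != v0))%N.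
Proof.
have disj : [disjoint D v & [set w | v \in D w]].
  rewrite disjoints_subset; apply/subsetP=> w wD; rewrite !inE.
  apply/negP => /andP[_ /eqP]; have := level_daughter wD; lia.
rewrite /degree; have -> : [set w | e v w] = D v :|: [set w | v \in D w].
  by apply/setP=> w; rewrite in_set edge_daughters in_setU in_set.
rewrite cardsU disjoint_setI0 // cards0 subn0; congr (_ + _)%N.
have [->|v_neq0] := eqVneq v v0.
  by apply: eq_card0 => w; rewrite inE (negPf (root_notin_daughters w)).
rewrite -[RHS](cards1 (parent v)); apply: eq_card => w; rewrite in_set in_set1.
apply/idP/eqP => [/daughter_parent //|->]; exact: parent_daughter.
Qed.

Lemma level_root v : (level e v0 v == 1%N) = (v == v0).
Proof.
have [_ _ _ size_v] := root_path_spec v.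
rewrite /level eqSS -size_v size_eq0 -root_path0.
exact: (inj_eq root_path_inj).
Qed.

(** * Level sizes and vertex sequences of a symmetric tree *)

Section Symmetric.

Hypothesis symP :
  forall u v, level e v0 u = level e v0 v -> degree e u = degree e v.

Lemma daughter_degree_level v : daughter_degree e v0 (level e v0 v) = #|D v|.
Proof.
rewrite /daughter_degree.
case: pickP => [u /eqP eq_uv|/(_ v)]; last by rewrite eqxx.
have := symP eq_uv; rewrite !degree_daughters -!level_root eq_uv; lia.
Qed.

(** The recursion for subtree sizes run for n levels, which gives an expression
    that visibly depends on the level only; n bounds the remaining depth. *)
Fixpoint iterated_size n i :=
  if n is n'.+1 then (daughter_degree e v0 i * iterated_size n' i.+1).+1
  else 1%N.

Lemma card_subtree_iterated n v : (#|V| <= n + level e v0 v)%N ->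
  #|subtree e v0 v| = iterated_size n (level e v0 v).
Proof.
elim: n v => [|n IHn] v le_V; rewrite card_subtree /=.
  rewrite big_pred0 // => w; apply/negP => wD.
  by have := level_le w; rewrite (level_daughter wD); lia.
congr _.+1; rewrite daughter_degree_level -sum_nat_const.
apply: eq_bigr => w wD; rewrite IHn (level_daughter wD) //; lia.
Qed.

Lemma level_size_level v : level_size e v0 (level e v0 v) = #|subtree e v0 v|.
Proof.
rewrite /level_size.
case: pickP => [u /eqP eq_uv|/(_ v)]; last by rewrite eqxx.
by rewrite !(@card_subtree_iterated #|V|) ?eq_uv // leq_addr.
Qed.

Lemma level_size_rec i : (0 < level_size e v0 i)%N ->
  level_size e v0 i = (daughter_degree e v0 i * level_size e v0 i.+1).+1.
Proof.
rewrite {1}/level_size; case: pickP => // v /eqP <- _.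
rewrite level_size_level card_subtree daughter_degree_level -sum_nat_const.
congr _.+1; apply: eq_bigr => w wD.
by rewrite -level_size_level (level_daughter wD).
Qed.

Lemma level_size_succ_gt0 i :
  (0 < daughter_degree e v0 i)%N -> (0 < level_size e v0 i.+1)%N.
Proof.
rewrite {1}/daughter_degree; case: pickP => // v /eqP <- /card_gt0P[w wD].
by rewrite -(level_daughter wD) level_size_level card_subtree.
Qed.

Lemma level_size1 : level_size e v0 1 = #|V|.
Proof.
have /eqP <- : level e v0 v0 == 1%N by rewrite level_root.
by rewrite level_size_level card_subtree_root.
Qed.

Variable lab : V -> V -> nat.
Hypothesis labP : daughter_edge_labels e v0 lab.

Notation k := (daughter_degree e v0).
Notation h := (level_size e v0).
Notation x := (vertex_seq e v0 lab).

Lemma vertex_seq_root : x v0 = [::].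
Proof. by rewrite /vertex_seq root_path0. Qed.

Lemma vertex_seq_daughter u w : w \in D u -> x w = rcons (x u) (lab u w).
Proof.
rewrite mem_daughters /vertex_seq => /eqP->.
have [_ _ last_u _] := root_path_spec u.
by rewrite -cats1 pairmap_cat /= last_u cats1.
Qed.

Lemma size_vertex_seq v : (size (x v)).+1 = level e v0 v.
Proof.
by have [_ _ _ size_v] := root_path_spec v; rewrite size_pairmap size_v.
Qed.

Lemma vertex_seq_address v : address k 1 (x v).
Proof.
elim/tree_ind: v => [|u w wD IHu]; first by rewrite vertex_seq_root.
rewrite (vertex_seq_daughter wD) address_rcons IHu add1n size_vertex_seq.
by have [/(_ _ wD)] := labP u.
Qed.

Lemma vertex_seq_inj : injective x.
Proof.
move=> u; elim/tree_ind: u => [|u w wD IHu] v.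
  have [-> //|[v' /vertex_seq_daughter ->]] := root_or_daughter v.
  by rewrite vertex_seq_root; case: (x v').
rewrite (vertex_seq_daughter wD).
have [->|[v' vD]] := root_or_daughter v.
  by rewrite vertex_seq_root; case: (x u).
rewrite (vertex_seq_daughter vD) => /rcons_inj[/IHu def_v' eq_lab].
rewrite -def_v' in vD eq_lab; have [_ inj] := labP u; exact: inj eq_lab.
Qed.

End Symmetric.
End Tree.

(** * The labelling is graceful *)

Section Labelling.

Variables (V : finType) (e : rel V) (v0 : V).
Hypothesis treeP : is_tree e.
Hypothesis symP :
  forall u v, level e v0 u = level e v0 v -> degree e u = degree e v.
Variable lab : V -> V -> nat.
Hypothesis labP : daughter_edge_labels e v0 lab.

Notation k := (daughter_degree e v0).
Notation h := (level_size e v0).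
Notation x := (vertex_seq e v0 lab).
Notation f := (symmetric_tree_labelling e v0 lab).

Lemma symmetric_tree_labellingE v : f v = vertex_label k h 1 (x v).
Proof.
rewrite /symmetric_tree_labelling; have [->|v_neq0] := eqVneq v v0.
  by rewrite vertex_seq_root.
have := vertex_seq_address treeP labP v.
have := size_vertex_seq v0 treeP lab v.
case: (x v) => [/= /esym/eqP|y ys <-].
  by rewrite level_root // (negPf v_neq0).
move=> add_v.
have h_rec := level_size_rec treeP symP.
have h_gt0 := level_size_succ_gt0 treeP symP.
have /= -> := vertex_labelE h_rec h_gt0 add_v.
have eq_tail :
    \sum_(2 <= j < (size ys).+2) (nth 0%N (y :: ys) j.-1)%:Z * (h j.+1)%:Z =
    \sum_(j < size ys) (nth 0%N ys j)%:Z * (h (1 + j).+2)%:Z.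
  rewrite -{1}[2%N]add0n -(addn2 (size ys)) big_addn addnK big_mkord.
  by apply: eq_bigr => j _; rewrite addn2.
rewrite /= !negbK; case: (odd (size ys)) => /=.
  by rewrite big_ltn // eq_tail.
by rewrite eq_tail subn2.
Qed.

Lemma symmetric_tree_labelling_graceful :
  graceful_labelling e f.
Proof.
have h_rec := level_size_rec treeP symP.
have h_gt0 := level_size_succ_gt0 treeP symP.
have h1 : h 1 = #|edges e|.+1 by rewrite (card_edges v0 treeP) level_size1.
have h1_gt0 : (0 < h 1)%N by rewrite h1.
have addr := vertex_seq_address treeP labP.
have neq_nil w : w != v0 -> x w != [::].
  apply: contra_neq => xw; apply: (vertex_seq_inj treeP labP).
  by rewrite xw vertex_seq_root.
(* The edge at w towards the root is determined by w, so the distinctness of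
   edge labels reduces to that of signed labels of sequences. *)
have edge_label u v : e u v -> exists w,
    [/\ w != v0, [set u; v] = [set parent e v0 w; w]
      & `|f u - f v| = `|signed_edge_label k h 1 (x w)|].
  have norm_step a b : b \in daughters e v0 a ->
      `|vertex_label k h 1 (x b) - vertex_label k h 1 (x a)| =
      `|signed_edge_label k h 1 (x b)|.
    move=> bD; rewrite (vertex_seq_daughter treeP lab bD) vertex_label_rcons.
    by rewrite normrM normrX normrN1 expr1n mul1r.
  rewrite (edge_daughters v0 treeP) !symmetric_tree_labellingE.
  case/orP=> [vD|uD]; [exists v | exists u; rewrite setUC].
    rewrite (daughter_parent treeP vD) distrC norm_step //.
    by rewrite (daughter_neq_root treeP vD).
  rewrite (daughter_parent treeP uD) norm_step //.
  by rewrite (daughter_neq_root treeP uD).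
split.
- move=> u v; rewrite !symmetric_tree_labellingE => eq_uv.
  by apply: (vertex_seq_inj treeP labP); apply: vertex_label_inj eq_uv.
- move=> v; rewrite symmetric_tree_labellingE.
  by have := vertex_label_bounds h_rec h_gt0 (addr v) h1_gt0; rewrite h1; lia.
- move=> u v /edge_label[w [w0 _ ->]].
  have := signed_edge_label_bounds h_rec h_gt0 (addr w) h1_gt0 (neq_nil _ w0).
  by rewrite h1; lia.
move=> u v u' v' /edge_label[w [w0 -> ->]] /edge_label[w' [w'0 -> ->]] eq_ww'.
suff -> : w = w' by [].
apply: (vertex_seq_inj treeP labP).
exact: signed_edge_label_inj (neq_nil _ w0) (neq_nil _ w'0) eq_ww'.
Qed.

End Labelling.

Theorem theorem1 (V : finType) (e : rel V) (v0 : V) :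
  rooted_symmetric_tree e v0 ->
  graceful e /\
  (forall lab : V -> V -> nat, daughter_edge_labels e v0 lab ->
     graceful_labelling e (symmetric_tree_labelling e v0 lab)).
Proof.
case=> treeP symP; split; last first.
  by move=> lab; apply: symmetric_tree_labelling_graceful.
(* Any enumeration of the daughters provides edge labels. *)
pose lab u v := index v (enum (daughters e v0 u)).
exists (symmetric_tree_labelling e v0 lab).
apply: symmetric_tree_labelling_graceful => // u; split=> [v vD|v w vD wD].
  by rewrite daughter_degree_level // cardE index_mem mem_enum.
by apply: (index_inj v0); rewrite mem_enum.
Qed.
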